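(* Let $\lambda$ be a non-zero real number and let $r$ be a positive integer. For every integer $n\ge 0$, $$\beta_{n,\lambda}^{(r)}(x)=n!\sum_{k=0}^{n}\Bigg\{\sum_{\substack{0\le l\le n-k\\ l\ \mathrm{even}}}\frac{(1)_{\frac{l}{2},\lambda}\,\beta_{n-k-l,\lambda}^{(r)}}{k!\,(n-k-l)!\,\big(\frac{l}{2}\big)!\,2^{k+l}}\Bigg\}H_{k,\lambda}(x),$$ where $\beta_{n,\lambda}^{(r)}(x)$ and $\beta_{n,\lambda}^{(r)}=\beta_{n,\lambda}^{(r)}(0)$ are the degenerate Bernoulli polynomials and numbers of order $r$, and $H_{k,\lambda}(x)$ are the degenerate Hermite polynomials.
   Context: Fix a non-zero real number $\lambda$. The degenerate falling factorials are $(x)_{0,\lambda}=1$ and $(x)_{n,\lambda}=x(x-\lambda)(x-2\lambda)\cdots(x-(n-1)\lambda)$ for $n\ge 1$. The degenerate exponential functions are $e_\lambda^x(t)=(1+\lambda t)^{x/\lambda}=\sum_{n\ge 0}(x)_{n,\lambda}\frac{t^n}{n!}$, regarded as formal power series in $t$, and $e_\lambda(t)=e_\lambda^1(t)$. The degenerate Hermite polynomials $H_{n,\lambda}(x)$ are defined by $$e_\lambda^{-1}(t^2)\, e_\lambda^{x}(2t)=\sum_{n=0}^\infty H_{n,\lambda}(x)\frac{t^n}{n!}.$$ The degenerate Bernoulli polynomials of order $r$ are defined by $$\bigg(\frac{t}{e_\lambda(t)-1}\bigg)^{r}e_\lambda^x(t)=\sum_{n=0}^\infty \beta_{n,\lambda}^{(r)}(x)\frac{t^n}{n!},$$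 and $\beta_{n,\lambda}^{(r)}=\beta_{n,\lambda}^{(r)}(0)$ are the degenerate Bernoulli numbers of order $r$. *)

(* Defs.v *)
From HB Require Import structures.
From mathcomp Require Import all_boot all_order all_algebra.
From mathcomp Require Import boolp reals.

Set Implicit Arguments.
Unset Strict Implicit.
Unset Printing Implicit Defensive.

Import Order.TTheory GRing.Theory Num.Theory.
Local Open Scope ring_scope.

(* [f n] is the coefficient of t^n.  A record, rather than an alias of
   [nat -> R], so that the Cauchy product does not compete with the pointwise
   ring structure on functions. *)
Record fps (R : Type) := Fps { fps_coef :> nat -> R }.

HB.instance Definition _ (R : Type) := [isNew for @fps_coef R].
HB.instance Definition _ (R : choiceType) := [Choice of fps R by <:].

Lemma fpsP (R : Type) (f g : fps R) : (forall n, f n = g n) -> f = g.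
Proof. by case: f g => f [g] /= fg; congr Fps; apply/funext. Qed.

Section FpsZmod.
Variable V : zmodType.
Implicit Types f g : fps V.

Definition fps_zero : fps V := Fps (fun=> 0).
Definition fps_opp f : fps V := Fps (fun n => - f n).
Definition fps_add f g : fps V := Fps (fun n => f n + g n).

Fact fps_addA : associative fps_add.
Proof. by move=> f g h; apply: fpsP => n /=; rewrite addrA. Qed.
Fact fps_addC : commutative fps_add.
Proof. by move=> f g; apply: fpsP => n /=; rewrite addrC. Qed.
Fact fps_add0 : left_id fps_zero fps_add.
Proof. by move=> f; apply: fpsP => n /=; rewrite add0r. Qed.
Fact fps_addN : left_inverse fps_zero fps_opp fps_add.
Proof. by move=> f; apply: fpsP => n /=; rewrite addNr. Qed.

HB.instance Definition _ :=
  GRing.isZmodule.Build (fps V) fps_addA fps_addC fps_add0 fps_addN.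

Lemma coef_fps0 n : (0 : fps V) n = 0. Proof. by []. Qed.
Lemma coef_fpsD f g n : (f + g) n = f n + g n. Proof. by []. Qed.
Lemma coef_fpsN f n : (- f) n = - f n. Proof. by []. Qed.
End FpsZmod.

Section FpsRing.
Variable R : comNzRingType.
Implicit Types f g h : fps R.

Definition fps_one : fps R := Fps (fun n => (n == 0)%:R).
Definition fps_mul f g : fps R :=
  Fps (fun n => \sum_(i < n.+1) f i * g (n - i)%N).

Let trunc m f : {poly R} := \poly_(i < m) f i.

Let fps_mul_trunc f g m n : (n < m)%N ->
  fps_mul f g n = (trunc m f * trunc m g)`_n.
Proof.
move=> lt_nm; rewrite coefM; apply: eq_bigr => i _; rewrite !coef_poly.
rewrite (leq_ltn_trans _ lt_nm) ?(leq_ltn_trans _ lt_nm) //.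
  by rewrite leq_subr.
by rewrite -ltnS.
Qed.

Fact fps_mulC : commutative fps_mul.
Proof.
by move=> f g; apply: fpsP => n; rewrite !(fps_mul_trunc _ _ (ltnSn n)) mulrC.
Qed.

Fact fps_mulA : associative fps_mul.
Proof.
move=> f g h; apply: fpsP => n.
have tr f1 g1 i : (i < n.+1)%N ->
    (trunc n.+1 (fps_mul f1 g1))`_i = (trunc n.+1 f1 * trunc n.+1 g1)`_i.
  by move=> lti; rewrite coef_poly lti (fps_mul_trunc _ _ lti).
rewrite !(fps_mul_trunc _ _ (ltnSn n)).
transitivity (trunc n.+1 f * (trunc n.+1 g * trunc n.+1 h))`_n.
  rewrite !coefM; apply: eq_bigr => i _.
  by rewrite tr // ltnS leq_subr.
rewrite mulrA [LHS]coefM [RHS]coefM; apply: eq_bigr => i _.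
by rewrite tr.
Qed.

Fact fps_mul1 : left_id fps_one fps_mul.
Proof.
move=> f; apply: fpsP => n /=; rewrite big_ord_recl /= mul1r subn0.
by rewrite big1 ?addr0 // => i _; rewrite mul0r.
Qed.

Fact fps_mulDl : left_distributive fps_mul (@fps_add R).
Proof.
move=> f g h; apply: fpsP => n /=; rewrite -big_split /=.
by apply: eq_bigr => i _; rewrite mulrDl.
Qed.

Fact fps_one_neq0 : fps_one != 0.
Proof.
apply/eqP => /(congr1 (fun f : fps R => f 0%N)) /= /eqP.
by rewrite (oner_eq0 R).
Qed.

HB.instance Definition _ := GRing.Zmodule_isComNzRing.Build (fps R)
  fps_mulA fps_mulC fps_mul1 fps_mulDl fps_one_neq0.

Lemma coef_fps1 n : (1 : fps R) n = (n == 0)%:R. Proof. by []. Qed.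
Lemma coef_fpsM f g n : (f * g) n = \sum_(i < n.+1) f i * g (n - i)%N.
Proof. by []. Qed.

Definition fpsX : fps R := Fps (fun n => (n == 1)%:R).

(* f(g(t)).  Since g^k has no term below t^k when g has no constant term, the
   sum below is then the coefficient of t^n in \sum_k f_k g(t)^k; this is junk
   when g 0 <> 0. *)
Definition fps_comp f g : fps R :=
  Fps (fun n => \sum_(k < n.+1) f k * (g ^+ k) n).

(* (f(t) - f(0)) / t *)
Definition fps_shift f : fps R := Fps (fun n => f n.+1).

Lemma coef_fpsMX f n : (f * fpsX) n = if n is m.+1 then f m else 0.
Proof.
rewrite mulrC coef_fpsM; case: n => [|n] /=; first by rewrite big_ord1 mul0r.
rewrite 2!big_ord_recl /= mul0r add0r mul1r subSS subn0.
by rewrite big1 ?addr0 // => i _; rewrite mul0r.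
Qed.

Lemma fps_shiftK f : f 0%N = 0 -> fps_shift f * fpsX = f.
Proof. by move=> f0; apply: fpsP => -[|n]; rewrite coef_fpsMX ?f0. Qed.

End FpsRing.
Arguments fpsX {R}.

Section FpsUnitRing.
Variable R : comUnitRingType.
Implicit Types f g : fps R.

(* The first n coefficients of 1/f. *)
Fixpoint fps_inv_seq f n : seq R :=
  if n is m.+1 then
    let s := fps_inv_seq f m in
    rcons s ((f 0%N)^-1 * ((m == 0)%:R - \sum_(i < m) s`_i * f (m - i)%N))
  else [::].

Definition fps_unit : {pred fps R} := [pred f : fps R | f 0%N \is a GRing.unit].
Definition fps_inv f : fps R :=
  if f \in fps_unit then Fps (fun n => (fps_inv_seq f n.+1)`_n) else f.

Let size_fps_inv_seq f n : size (fps_inv_seq f n) = n.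
Proof. by elim: n => //= n IHn; rewrite size_rcons IHn. Qed.

Let nth_fps_inv_seq f m n : (n < m)%N ->
  (fps_inv_seq f m)`_n = (fps_inv_seq f n.+1)`_n.
Proof.
elim: m => // m IHm; rewrite ltnS leq_eqVlt => /predU1P[-> //|lt_nm].
by rewrite [LHS]/= nth_rcons size_fps_inv_seq lt_nm IHm.
Qed.

Fact fps_mulVf : {in fps_unit, left_inverse 1 fps_inv *%R}.
Proof.
move=> f f_unit; apply: fpsP => n; rewrite /fps_inv f_unit coef_fpsM /=.
rewrite big_ord_recr /= subnn nth_rcons size_fps_inv_seq ltnn eqxx.
rewrite [X in _ + X]mulrC mulrA divrr // mul1r.
rewrite (eq_bigr (fun i : 'I_n => (fps_inv_seq f n)`_i * f (n - i)%N)).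
  by rewrite addrC subrK.
by move=> i _; rewrite [in RHS]nth_fps_inv_seq.
Qed.

Fact fps_unitPl f g : g * f = 1 -> fps_unit f.
Proof.
move/(congr1 (fun f : fps R => f 0%N)).
rewrite coef_fpsM big_ord1 coef_fps1 /= => gf1.
by apply/unitrPr; exists (g 0%N); rewrite mulrC.
Qed.

Fact fps_inv_out : {in [predC fps_unit], fps_inv =1 id}.
Proof. by move=> f /negbTE fN; rewrite /fps_inv fN. Qed.

HB.instance Definition _ := GRing.ComNzRing_hasMulInverse.Build (fps R)
  fps_mulVf fps_unitPl fps_inv_out.

Lemma fps_unitE f : (f \is a GRing.unit) = (f 0%N \is a GRing.unit).
Proof. by []. Qed.
End FpsUnitRing.

Section Degenerate.
Variable R : realType.
Implicit Types (lambda x : R) (n r : nat).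

Definition dfact lambda x n : R := \prod_(i < n) (x - i%:R * lambda).

(* (1 + lambda t)^(x / lambda), through the binomial series: the coefficient
   of t^n is binom(x / lambda, n) lambda^n = (x)_{n,lambda} / n!. *)
Definition dexp lambda x : fps R :=
  Fps (fun n => dfact lambda x n / n`!%:R).

Definition dHermite lambda n x : R :=
  n`!%:R * (fps_comp (dexp lambda (-1)) (fpsX ^+ 2)
            * fps_comp (dexp lambda x) (fpsX *+ 2)) n.

(* t / (e_lambda(t) - 1): the denominator has no constant term, hence is not
   invertible, so a factor t is cancelled first; see [t_over_dexpB1P]. *)
Definition t_over_dexpB1 lambda : fps R := (fps_shift (dexp lambda 1 - 1))^-1.

Lemma t_over_dexpB1P lambda (q : fps R) :
  q * (dexp lambda 1 - 1) = fpsX <-> q = t_over_dexpB1 lambda.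
Proof.
set e := dexp lambda 1 - 1.
have e0 : e 0%N = 0.
  by rewrite coef_fpsD coef_fpsN /= /dfact big_ord0 divr1 subrr.
have u : fps_shift e \is a GRing.unit.
  rewrite fps_unitE /= /dfact big_ord1 mul0r !subr0 divr1.
  exact: unitr1.
split=> [qe|->]; last by rewrite -{1}(fps_shiftK e0) mulrA mulVr // mul1r.
apply: (mulIr u); rewrite mulVr //; apply: fpsP => n.
have := congr1 (fun f : fps R => f n.+1) qe.
by rewrite -{1}(fps_shiftK e0) mulrA coef_fpsMX.
Qed.

Definition dBernoulli lambda r n x : R :=
  n`!%:R * (t_over_dexpB1 lambda ^+ r * dexp lambda x) n.

Definition dBernoulli_number lambda r n : R := dBernoulli lambda r n 0.

End Degenerate.

(* Main.v *)
(* With A(t) = e_lambda(t^2/4), replacing t by t/2 in the Hermite generating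
   function gives A(t)^-1 e_lambda^x(t), because e_lambda^1 e_lambda^(-1) = 1.
   Hence the Bernoulli generating function (t / (e_lambda(t) - 1))^r e_lambda^x
   factors as the rescaled Hermite generating function, times A(t), times the
   generating function of the Bernoulli numbers, and the theorem compares the
   coefficients of t^n. *)
Require Import Defs.
From mathcomp Require Import all_boot all_order all_algebra.
From mathcomp Require Import boolp reals.
From mathcomp Require Import ring.

Import Order.TTheory GRing.Theory Num.Theory.
Local Open Scope ring_scope.

Section Substitutions.
Variable R : comNzRingType.
Implicit Types (f g : fps R) (c : R).

Lemma coef_fpsMn f m n : (f *+ m) n = f n *+ m.
Proof. by elim: m => // m IHm; rewrite !mulrS coef_fpsD IHm. Qed.

Lemma coef_fpsXn k n : (fpsX ^+ k : fps R) n = (n == k)%:R.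
Proof.
elim: k n => [|k IHk] n; first by rewrite expr0 coef_fps1.
by rewrite exprSr coef_fpsMX; case: n.
Qed.

Lemma coef_fps_comp2X f n : fps_comp f (fpsX *+ 2) n = 2 ^+ n * f n.
Proof.
have coef_2Xn k : ((fpsX *+ 2) ^+ k : fps R) n = (n == k)%:R *+ 2 ^ k.
  by rewrite (exprMn_n fpsX) coef_fpsMn coef_fpsXn.
rewrite /= big_ord_recr /= big1 => [|i _].
  by rewrite add0r coef_2Xn eqxx natrX mulrC.
by rewrite coef_2Xn gtn_eqF // mul0rn mulr0.
Qed.

Lemma coef_fps_compX2 f n :
  fps_comp f (fpsX ^+ 2) n = if odd n then 0 else f n./2.
Proof.
rewrite /=; under eq_bigr do rewrite -exprM coef_fpsXn mul2n.
case: ifP => [odd_n | /negbT even_n].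
  rewrite big1 // => i _; case: eqP => [n_eq|]; last by rewrite mulr0.
  by rewrite n_eq odd_double in odd_n.
have lt_n2 : (n./2 < n.+1)%N
  by rewrite ltnS leq_half_double -addnn -addnS leq_addr.
rewrite (bigD1 (Ordinal lt_n2)) //= even_halfK // eqxx mulr1 big1 ?addr0 //.
move=> i; rewrite -val_eqE /= => i_neq.
case: eqP => [n_eq|]; last by rewrite mulr0.
by case/eqP: i_neq; rewrite [in RHS]n_eq doubleK.
Qed.

Lemma sum_even (F : nat -> R) m :
  \sum_(i < m.*2.+1 | ~~ odd i) F i = \sum_(i < m.+1) F i.*2.
Proof.
elim: m => [|m IHm]; first by rewrite big_mkcond !big_ord1.
rewrite [RHS]big_ord_recr -IHm big_mkcond doubleS 2!big_ord_recr /=.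
by rewrite odd_double /= addr0 -big_mkcond.
Qed.

(** The Cauchy product pairs degrees [i] and [n - i]. For odd [n] one of them is odd and every term
    vanishes; for even [n] only even [i] survive, and halving them gives back the product of [f] and
    [g]. *)
Lemma fps_compX2M f g :
  fps_comp (f * g) (fpsX ^+ 2) =
  fps_comp f (fpsX ^+ 2) * fps_comp g (fpsX ^+ 2).
Proof.
apply: fpsP => n; rewrite coef_fps_compX2 [RHS]coef_fpsM.
under [RHS]eq_bigr do rewrite !coef_fps_compX2.
case: ifP => [odd_n | /negbT even_n].
  rewrite big1 // => i _; rewrite oddB ?odd_n -1?ltnS //.
  by case: (odd i); rewrite /= ?mul0r ?mulr0.
rewrite -(even_halfK even_n) doubleK; move: (n./2) => m.
transitivity (\sum_(i < m.*2.+1 | ~~ odd i) f i./2 * g (m.*2 - i)./2).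
  rewrite (sum_even (fun i => f i./2 * g (m.*2 - i)./2)) coef_fpsM.
  by apply: eq_bigr => i _; rewrite -doubleB !doubleK.
rewrite big_mkcond; apply: eq_bigr => i _; rewrite oddB -1?ltnS // odd_double.
by case: (odd i); rewrite /= ?mul0r.
Qed.

Lemma fps_comp1X2 : fps_comp 1 (fpsX ^+ 2) = 1 :> fps R.
Proof.
by apply: fpsP => -[|[|n]]; rewrite coef_fps_compX2 //=; case: ifP.
Qed.

(** The substitution of c t for t, given coefficientwise so that multiplicativity reduces to c^i
    c^(n-i) = c^n. *)
Definition fps_scale c f : fps R := Fps (fun n => c ^+ n * f n).

Lemma coef_fps_scale c f n : fps_scale c f n = c ^+ n * f n.
Proof. by []. Qed.

Lemma fps_scaleM c f g : fps_scale c (f * g) = fps_scale c f * fps_scale c g.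
Proof.
apply: fpsP => n /=; rewrite big_distrr /=; apply: eq_bigr => i _.
by rewrite mulrACA -exprD subnKC // -ltnS.
Qed.

End Substitutions.
Arguments fps_scale {R}.

Section DegenerateExp.
Variable R : realType.
Implicit Types lambda x y : R.

Lemma coef_dexp0 lambda x : dexp lambda x 0 = 1.
Proof. by rewrite /= /dfact big_ord0 divr1. Qed.

Lemma coef_dexpS lambda x n :
  n.+1%:R * dexp lambda x n.+1 = (x - n%:R * lambda) * dexp lambda x n.
Proof.
rewrite /= /dfact big_ord_recr /= factS natrM.
have n1_neq0 : n.+1%:R != 0 :> R by rewrite pnatr_eq0.
have nf_neq0 : n`!%:R != 0 :> R by rewrite pnatr_eq0 -lt0n fact_gt0.
by field; rewrite -mulrS n1_neq0 nf_neq0.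
Qed.

(* Both sides have constant term 1 and satisfy the recurrence [coef_dexpS] of
   (1 + lambda t) F' = (x + y) F. *)
Lemma dexpD lambda x y :
  dexp lambda (x + y) = dexp lambda x * dexp lambda y.
Proof.
apply: fpsP; elim=> [|n IHn].
  by rewrite coef_fpsM big_ord1 !coef_dexp0 mulr1.
have n1_neq0 : n.+1%:R != 0 :> R by rewrite pnatr_eq0.
apply: (mulfI n1_neq0); rewrite coef_dexpS IHn !coef_fpsM {IHn} !mulr_sumr.
move: (coef_dexpS lambda x) (coef_dexpS lambda y).
move: (dexp lambda x) (dexp lambda y) => a b a_rec b_rec.
(* Product rule: this is the coefficient of t^n in a' b + a b'. *)
transitivity (\sum_(i < n.+2) i%:R * a i * b (n.+1 - i)%N
              + \sum_(i < n.+2) a i * ((n.+1 - i)%:R * b (n.+1 - i)%N)).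
  (* The term [i = 0] of the first sum and the term [i = n.+1] of the second have weight 0; without
     them both sums have [n.+1] terms. *)
  rewrite [X in _ = X + _]big_ord_recl [X in _ = _ + X]big_ord_recr /=.
  rewrite subnn !mul0r add0r mulr0 addr0 -big_split /=; apply: eq_bigr => i _.
  rewrite /bump leq0n add1n subSS a_rec subSn -1?ltnS // b_rec.
  (* This splits x + y - n lambda into the factors x - i lambda and y - (n - i) lambda of the two
     recurrences. *)
  have -> : n%:R = i%:R + (n - i)%:R :> R by rewrite -natrD subnKC // -ltnS.
  ring.
rewrite -big_split /=; apply: eq_bigr => i _.
have -> : n.+1%:R = i%:R + (n.+1 - i)%:R :> R by rewrite -natrD subnKC // -ltnS.
ring.
Qed.

Lemma dexp0 lambda : dexp lambda 0 = 1.
Proof.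
apply: fpsP => -[|n]; first by rewrite coef_dexp0.
by rewrite /= /dfact big_ord_recl /= mul0r subr0 !mul0r.
Qed.

Lemma dBernoulli_numberE lambda r n :
  dBernoulli_number lambda r n = n`!%:R * (t_over_dexpB1 lambda ^+ r) n.
Proof. by rewrite /dBernoulli_number /dBernoulli dexp0 mulr1. Qed.

(** The last factor is A(t): by [dexpD] it cancels e_lambda^(-1)(t^2/4), while scaling by 1/2 turns
    2t back into t. *)
Lemma dexp_fps_scale_comp lambda x :
  dexp lambda x =
  fps_scale 2^-1 (fps_comp (dexp lambda (-1)) (fpsX ^+ 2)
                  * fps_comp (dexp lambda x) (fpsX *+ 2))
  * fps_scale 2^-1 (fps_comp (dexp lambda 1) (fpsX ^+ 2)).
Proof.
rewrite -fps_scaleM mulrAC -fps_compX2M -dexpD addNr dexp0 fps_comp1X2 mul1r.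
apply: fpsP => n; rewrite coef_fps_scale coef_fps_comp2X.
by rewrite mulrA -exprMn mulVf ?expr1n ?mul1r // pnatr_eq0.
Qed.

End DegenerateExp.

Theorem theorem3 (R : realType) (lambda : R) (r : nat)
    (hlambda : lambda != 0) (hr : (0 < r)%N) (n : nat) (x : R) :
  dBernoulli lambda r n x =
  n`!%:R *
  \sum_(0 <= k < n.+1)
    (\sum_(0 <= l < (n - k).+1 | ~~ odd l)
        (dfact lambda 1 l./2 * dBernoulli_number lambda r (n - k - l))
        / (k`!%:R * (n - k - l)`!%:R * (l./2)`!%:R * 2 ^+ (k + l)))
    * dHermite lambda k x.
Proof.
have fact_neq0 m : m`!%:R != 0 :> R by rewrite pnatr_eq0 -lt0n fact_gt0.
have two_neq0 m : 2 ^+ m != 0 :> R by rewrite expf_neq0 // pnatr_eq0.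
(* With the factors in this order, the outer Cauchy product runs over the Hermite degree k and the
   inner one over the degree l of A(t), which leaves n - k - l to the Bernoulli numbers. *)
rewrite /dBernoulli [_ ^+ r * _]mulrC [X in X * _ ^+ r]dexp_fps_scale_comp.
rewrite -mulrA; congr (_ * _).
rewrite coef_fpsM big_mkord; apply: eq_bigr => k _.
rewrite coef_fpsM big_mkord [in RHS]big_mkcond mulr_sumr mulr_suml.
apply: eq_bigr => l _; rewrite dBernoulli_numberE /dHermite.
rewrite !coef_fps_scale coef_fps_compX2.
move: (fps_coef (_ ^+ r) _) (fps_coef (_ * _) k) => b h.
(* A(t) has no odd-degree terms, whence the parity condition on [l]. *)
case: (odd l) => /=; first by rewrite !(mulr0, mul0r).
(* The k! and (n-k-l)! from [dHermite] and [dBernoulli_number] cancel those in the denominator; the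
   two scalings supply 2^-(k+l). *)
rewrite exprD !exprVn.
by field; rewrite !two_neq0 !fact_neq0.
Qed.
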